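(* Let $X\subset\mathbb{R}^2$ be a finite set with $n=|X|\geq 3$ points, equipped with the restriction of the Manhattan metric $d_1$. Let $x_1\leq x_2\leq\cdots\leq x_n$ be the abscissas of the points of $X$ and $y_1\leq y_2\leq\cdots\leq y_n$ the ordinates of the points of $X$, both listed in non-decreasing order with multiplicity, and let $S_X=[x_2,x_{n-1}]\times[y_2,y_{n-1}]$. Then for every $a\in X$, the metric center $m_a$ of $a$ is the point of $S_X$ nearest to $a$ with respect to $d_1$, or, what is the same, with respect to the Euclidean metric (this point is called the projection of $a$ on $S_X$). In particular, $m_a=a$ for every $a\in X\cap S_X$. Thus the metric center $m(X)$ of $X$ consists of the points of $X$ contained in $S_X$ together with the projections onto $S_X$ of the points of $X$ outside $S_X$.
   Context: The Manhattan metric on $\mathbb{R}^2$ is $d_1((x_1,y_1),(x_2,y_2))=|x_1-x_2|+|y_1-y_2|$. For $a,b,c\in\mathbb{R}^2$, the metric center $m(a,b,c)$ is the unique point $m\in\mathbb{R}^2$ with $d_1(a,b)=d_1(a,m)+d_1(m,b)$, $d_1(a,c)=d_1(a,m)+d_1(m,c)$ and $d_1(b,c)=d_1(b,m)+d_1(m,c)$. The Gromov product at $a$ with respect to $b,c$ is $\triangle_{a,bc}=\frac12\big(d_1(a,b)+d_1(a,c)-d_1(b,c)\big)$. For a finite set $X\subset\mathbb{R}^2$ with $|X|\ge3$ and $a\in X$, choose distinct $b,c\in X\setminus\{a\}$ for which $\triangle_{a,bc}$ is minimal among all such pairs; the metric center of $a$ is $m_a=m(a,b,c)$ (it does not depend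 on the choice of the minimizing pair). The metric center of $X$ is the set $m(X)=\{m_a: a\in X\}$. *)

(* Defs.v *)
From mathcomp Require Import all_boot all_order all_algebra.
From mathcomp Require Import finmap lra.
From mathcomp Require Import all_classical all_reals.

Set Implicit Arguments.
Unset Strict Implicit.
Unset Printing Implicit Defensive.

Import Order.TTheory GRing.Theory Num.Theory.

Local Open Scope fset_scope.
Local Open Scope classical_set_scope.
Local Open Scope ring_scope.

Section Definitions.
Variable R : realType.
Implicit Types (a b c m p q : R * R) (X : {fset (R * R)}) (S : set (R * R)).

Definition d1 p q : R := `|p.1 - q.1| + `|p.2 - q.2|.

Definition d2 p q : R := Num.sqrt ((p.1 - q.1) ^+ 2 + (p.2 - q.2) ^+ 2).

Definition is_metric_center a b c m : Prop :=
  [/\ d1 a b = d1 a m + d1 m b,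
      d1 a c = d1 a m + d1 m c &
      d1 b c = d1 b m + d1 m c].

(* The default value [a] of [xget] is never used: see [metric_center_exists]
   and [metric_center_unique]. *)
Definition metric_center a b c : R * R := xget a (is_metric_center a b c).

Definition gromov a b c : R := (d1 a b + d1 a c - d1 b c) / 2.

Definition admissible_pair X a b c : Prop :=
  [/\ b \in (X `\ a)%fset, c \in (X `\ a)%fset & b != c].

Definition minimizing_pair X a b c : Prop :=
  admissible_pair X a b c /\
  forall b' c', admissible_pair X a b' c' -> gromov a b c <= gromov a b' c'.

(* The point m_a. The default value [a] is not used when [X] has at least three
   points ([minimizing_pair_exists]), and the value is the same for every
   minimizing pair ([center_ofE]). *)
Definition center_of X a : R * R :=
  xget a [set m | exists b c,
    minimizing_pair X a b c /\ m = metric_center a b c].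

Definition center_set X : set (R * R) := [set center_of X a | a in [set` X]].

Definition abscissas X : seq R := sort <=%R [seq p.1 | p <- enum_fset X].
Definition ordinates X : seq R := sort <=%R [seq p.2 | p <- enum_fset X].

(* Entries are numbered from 0: with n = #|` X|, the second entry has index 1
   and the last but one has index n - 2. *)
Definition SX X : set (R * R) :=
  `[(abscissas X)`_1, (abscissas X)`_(#|` X| - 2)] `*`
  `[(ordinates X)`_1, (ordinates X)`_(#|` X| - 2)].

Definition nearest_points (d : R * R -> R * R -> R) S a : set (R * R) :=
  [set p | S p /\ forall q, S q -> d a p <= d a q].

(* Meaningful when the nearest point exists and is unique. *)
Definition projection_on S a : R * R := xget a (nearest_points d1 S a).

End Definitions.

Section WellDefined.
Variable R : realType.

Let norm_ge (x y : R) : (x - y <= `|x - y|) * (y - x <= `|x - y|).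
Proof. by split; [exact: ler_norm | rewrite distrC ler_norm]. Qed.

Let between_norm (x y m : R) : x <= m <= y -> `|x - y| = `|x - m| + `|m - y|.
Proof.
move=> /andP[xm my]; have xy := le_trans xm my.
by rewrite !ler0_norm ?subr_le0 //; lra.
Qed.

Let between_le (x y m : R) : x <= y -> `|x - y| = `|x - m| + `|m - y| ->
  x <= m <= y.
Proof.
have [xm1 xm2] := norm_ge x m; have [my1 my2] := norm_ge m y.
by move=> xy; rewrite ler0_norm ?subr_le0 // => h; apply/andP; split; lra.
Qed.

Let between_ge (x y m : R) : y <= x -> `|x - y| = `|x - m| + `|m - y| ->
  y <= m <= x.
Proof.
have [xm1 xm2] := norm_ge x m; have [my1 my2] := norm_ge m y.
by move=> yx; rewrite ger0_norm ?subr_ge0 // => h; apply/andP; split; lra.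
Qed.

Let g (a b c : R) : R := (`|a - b| + `|a - c| - `|b - c|) / 2.

Let gC a b c : g a b c = g a c b.
Proof. by rewrite /g (distrC b) [X in X - _]addrC. Qed.

Let g_between a p q : p <= a <= q -> g a p q = 0.
Proof. by move=> /between_norm h; rewrite /g h (distrC p); lra. Qed.

Let g_le a p q : g a p q <= `|a - p|.
Proof. by have := ler_distD p a q; rewrite /g; lra. Qed.

Let g_above a b c : a <= b -> b <= c -> g a b c = b - a.
Proof.
move=> ab bc; have ac := le_trans ab bc.
by rewrite /g !ler0_norm ?subr_le0 //; lra.
Qed.

Let g_below a b c : b <= a -> c <= b -> g a b c = a - b.
Proof.
move=> ab bc; have ac := le_trans bc ab.
by rewrite /g !ger0_norm ?subr_ge0 //; lra.
Qed.

Let C1 (a b c m : R) := [/\ `|a - b| = `|a - m| + `|m - b|,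
  `|a - c| = `|a - m| + `|m - c| & `|b - c| = `|b - m| + `|m - c|].

Let C1C a b c m : C1 a b c m -> C1 a c b m.
Proof.
by case=> h1 h2 h3; split=> //; rewrite distrC h3 addrC distrC (distrC b).
Qed.

Let ordered (a b c : R) :=
  [\/ b <= a <= c, a < b <= c | c <= b < a].

Let orderedP a b c : ordered a b c \/ ordered a c b.
Proof.
have [ab|ab] := ltP a b; have [ac|ac] := ltP a c.
- by have [bc|/ltW bc] := lerP b c; [left|right]; apply: Or32; apply/andP.
- by right; apply: Or31; apply/andP; split=> //; exact: ltW.
- by left; apply: Or31; apply/andP; split=> //; exact: ltW.
- have [e|nba] := eqVneq b a.
    by right; apply: Or31; rewrite e lexx andbT.
  have [e|nca] := eqVneq c a.
    by left; apply: Or31; rewrite e lexx andbT.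
  have {nba}ba : b < a by rewrite lt_neqAle nba.
  have {nca}ca : c < a by rewrite lt_neqAle nca.
  by have [bc|/ltW bc] := lerP c b; [left|right]; apply: Or33; apply/andP.
Qed.

Let side (a b c m : R) :=
  [\/ [/\ b <= a, a <= c, m = a & g a b c = 0],
      [/\ a < b, b <= c, m = b & g a b c = b - a] |
      [/\ b < a, c <= b, m = b & g a b c = a - b]].

Let C1_side a b c m : ordered a b c -> C1 a b c m -> side a b c m.
Proof.
case=> /andP[h1 h2] [e1 e2 e3].
- apply: Or31; split=> //; last by rewrite g_between // h1.
  move: (between_ge h1 e1) (between_le h2 e2) => /andP[? ?] /andP[? ?]; lra.
- have ac := le_trans (ltW h1) h2.
  apply: Or32; split=> //; last by rewrite g_above // ltW.
  by move: (between_le (ltW h1) e1) (between_le h2 e3)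
    => /andP[? ?] /andP[? ?]; lra.
- apply: Or33; split=> //; last by rewrite g_below // ltW.
  by move: (between_ge (ltW h2) e1) (between_ge h1 e3)
    => /andP[? ?] /andP[? ?]; lra.
Qed.

Let C1P a b c m : C1 a b c m -> side a b c m \/ side a c b m.
Proof.
have [o|o] := orderedP a b c => h; [left|right]; apply: C1_side => //.
exact: C1C.
Qed.

(* On each line, the metric center is the median. *)
Let medP (a b c : R) :
  exists2 m, C1 a b c m & forall m', C1 a b c m' -> m' = m.
Proof.
have H x y : ordered a x y ->
    exists2 m, C1 a x y m & forall m', C1 a x y m' -> m' = m.
  move=> o; case: (o) => /andP[h1 h2].
  - exists a.
      by split; rewrite ?subrr ?normr0 ?add0r //; apply: between_norm; rewrite h1.
    by move=> m' /(C1_side o) [] [? ? ? ?]; lra.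
  - exists x.
      split; rewrite ?subrr ?normr0 ?addr0 ?add0r //.
      by apply: between_norm; rewrite (ltW h1).
    by move=> m' /(C1_side o) [] [? ? ? ?]; lra.
  - exists x.
      split; rewrite ?subrr ?normr0 ?addr0 ?add0r //.
      rewrite (distrC a y) (distrC a x) (distrC x y) [RHS]addrC.
      by apply: between_norm; rewrite h1 ltW.
    by move=> m' /(C1_side o) [] [? ? ? ?]; lra.
have [/H //|/H[m hm U]] := orderedP a b c.
by exists m => [|m' /C1C]; [exact: C1C | exact: U].
Qed.

Let sel (T : Type) (i : bool) (b c : T) := if i then b else c.

Let selN (T : Type) i (b c : T) : sel (~~ i) b c = sel i c b.
Proof. by case: i. Qed.

Let g_any a b c m q : C1 a b c m ->
  exists i, g a (sel i b c) q <= g a b c.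
Proof.
have H b' c' : side a b' c' m -> exists i, g a (sel i b' c') q <= g a b' c'.
  case=> -[h1 h2 _ ->].
  - have [qa|/ltW qa] := lerP q a.
      by exists false; rewrite gC g_between // qa.
    by exists true; rewrite g_between // h1.
  - by exists true; apply: le_trans (g_le _ _ _) _; rewrite /sel /= ltr0_norm; lra.
  - by exists true; apply: le_trans (g_le _ _ _) _; rewrite /sel /= gtr0_norm; lra.
case/C1P => /H [i hi]; first by exists i.
by exists (~~ i); rewrite selN gC [leRHS]gC gC.
Qed.

Let g_lt a b c m b' c' m' : C1 a b c m -> C1 a b' c' m' ->
  g a b c < g a b' c' ->
  exists i, forall j, g a (sel i b c) (sel j b' c') <= g a b c /\
    sel i b c != sel j b' c'.
Proof.
have H x y x' y' : side a x y m -> side a x' y' m' -> g a x y < g a x' y' ->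
  exists i, forall j, g a (sel i x y) (sel j x' y') <= g a x y /\
    sel i x y != sel j x' y'.
  case=> -[h1 h2 _ ->]; case=> -[h3 h4 _ ->] h5; try by exfalso; lra.
  - exists true => -[]; rewrite /= g_between ?lexx ?lt_eqF //; try lra;
    by apply/andP; split; lra.
  - exists false => -[]; rewrite /= gC g_between ?lexx ?gt_eqF //; try lra;
    by apply/andP; split; lra.
  - exists true => -[]; (split; last by rewrite lt_eqF //=; lra);
    by apply: le_trans (g_le _ _ _) _; rewrite /sel /= ltr0_norm; lra.
  - exists true => -[]; (split; last by rewrite gt_eqF //=; lra);
    by rewrite gC /= g_between; [lra | apply/andP; split; lra].
  - exists true => -[]; (split; last by rewrite lt_eqF //=; lra);
    by rewrite /= g_between; [lra | apply/andP; split; lra].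
  - exists true => -[]; (split; last by rewrite gt_eqF //=; lra);
    by apply: le_trans (g_le _ _ _) _; rewrite /sel /= gtr0_norm; lra.
case/C1P => s; case/C1P => s' lt_g.
- exact: H s s' lt_g.
- rewrite (gC _ b') in lt_g; have [i hi] := H _ _ _ _ s s' lt_g.
  by exists i => j; have := hi (~~ j); rewrite selN.
- rewrite (gC _ b) in lt_g *; have [i hi] := H _ _ _ _ s s' lt_g.
  by exists (~~ i) => j; have := hi j; rewrite selN.
- rewrite (gC _ b) (gC _ b') in lt_g *; have [i hi] := H _ _ _ _ s s' lt_g.
  by exists (~~ i) => j; have := hi (~~ j); rewrite !selN.
Qed.

Let g_eq a b c m b' c' m' : C1 a b c m -> C1 a b' c' m' ->
  g a b c = g a b' c' -> m <> m' -> 0 < g a b c /\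
  forall i j, g a (sel i b c) (sel j b' c') = 0 /\ sel i b c != sel j b' c'.
Proof.
have H x y x' y' : side a x y m -> side a x' y' m' -> g a x y = g a x' y' ->
  m <> m' -> 0 < g a x y /\
  forall i j, g a (sel i x y) (sel j x' y') = 0 /\ sel i x y != sel j x' y'.
  case=> -[h1 h2 -> ->]; case=> -[h3 h4 -> ->] h5 h6; try by exfalso; lra.
  - split=> [|i j]; first lra.
    rewrite gC g_between ?gt_eqF //; first by case: i; case: j; rewrite /=; lra.
    by apply/andP; split; case: i; case: j; rewrite /=; lra.
  - split=> [|i j]; first lra.
    rewrite g_between ?lt_eqF //; first by case: i; case: j; rewrite /=; lra.
    by apply/andP; split; case: i; case: j; rewrite /=; lra.
case/C1P => s; case/C1P => s' eq_g ne_m.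
- exact: H s s' eq_g ne_m.
- rewrite (gC _ b') in eq_g; have [? hi] := H _ _ _ _ s s' eq_g ne_m.
  by split=> // i j; have := hi i (~~ j); rewrite selN.
- rewrite (gC _ b) in eq_g *; have [? hi] := H _ _ _ _ s s' eq_g ne_m.
  by split=> // i j; have := hi (~~ i) j; rewrite selN.
- rewrite (gC _ b) (gC _ b') in eq_g *.
  have [? hi] := H _ _ _ _ s s' eq_g ne_m.
  by split=> // i j; have := hi (~~ i) (~~ j); rewrite !selN.
Qed.

Implicit Types (a b c m p q : R * R) (X : {fset (R * R)}).

Let gromovE a b c : gromov a b c = g a.1 b.1 c.1 + g a.2 b.2 c.2.
Proof. by rewrite /gromov /g /d1; lra. Qed.

Let metric_centerE a b c m : is_metric_center a b c m <->
  C1 a.1 b.1 c.1 m.1 /\ C1 a.2 b.2 c.2 m.2.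
Proof.
split=> [[]|[[h1 h2 h3] [h4 h5 h6]]]; rewrite /is_metric_center /d1; last by split; lra.
have T x y := (ler_distD m.1 x.1 y.1, ler_distD m.2 x.2 y.2) : _ * _.
have [? ?] := T a b; have [? ?] := T a c; have [? ?] := T b c.
by move=> h1 h2 h3; split; split; lra.
Qed.

Lemma metric_center_exists a b c : exists m, is_metric_center a b c m.
Proof.
have [x hx _] := medP a.1 b.1 c.1; have [y hy _] := medP a.2 b.2 c.2.
by exists (x, y); apply/metric_centerE.
Qed.

Lemma metric_center_unique a b c m m' :
  is_metric_center a b c m -> is_metric_center a b c m' -> m = m'.
Proof.
have [x _ hx] := medP a.1 b.1 c.1; have [y _ hy] := medP a.2 b.2 c.2.
have H p : is_metric_center a b c p -> p = (x, y).
  case/metric_centerE; case: p => p1 p2 /= -[? ? ?] [? ? ?].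
  by rewrite (hx p1) // (hy p2).
by move=> /H -> /H ->.
Qed.

Lemma metric_centerP a b c : is_metric_center a b c (metric_center a b c).
Proof. exact: (xgetPex a (metric_center_exists a b c)). Qed.

Lemma minimizing_pair_exists X a : (3 <= #|` X|)%N -> a \in X ->
  exists b c, minimizing_pair X a b c.
Proof.
move=> X3 aX; pose Y := (X `\ a)%fset.
have Y2 : (2 <= #|` Y|)%N by move: X3; rewrite (cardfsD1 a) aX.
have /fset0Pn[b bY] : Y != fset0 by rewrite -cardfs_gt0; apply: leq_trans Y2.
have /fset0Pn[c] : (Y `\ b)%fset != fset0.
  by rewrite -cardfs_gt0; move: Y2; rewrite (cardfsD1 b) bY.
rewrite in_fsetD1 => /andP[cb cY].
pose P (u : Y * Y) := val u.1 != val u.2.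
have P0 : P ([` bY]%fset, [` cY]%fset) by rewrite /P /= eq_sym.
pose F (u : Y * Y) := gromov a (val u.1) (val u.2).
case: (arg_minP F P0) => -[b0 c0] P1 Hmin.
exists (val b0), (val c0); split; first by split=> //; exact: valP.
by move=> b' c' [b'Y c'Y nbc]; exact: (Hmin ([` b'Y]%fset, [` c'Y]%fset)).
Qed.

Lemma minimizing_pair_center X a b c b' c' :
  minimizing_pair X a b c -> minimizing_pair X a b' c' ->
  metric_center a b c = metric_center a b' c'.
Proof.
move=> [[bX cX bc] min1] [[b'X c'X bc'] min2].
have le1 := min1 _ _ (And3 b'X c'X bc').
have le2 := min2 _ _ (And3 bX cX bc).
have M i j : sel i b c != sel j b' c' ->
    gromov a b c <= gromov a (sel i b c) (sel j b' c').
  by move=> ?; apply: min1; split=> //; [case: (i) | case: (j)].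
have ME i j : gromov a (sel i b c) (sel j b' c') =
    g a.1 (sel i b.1 c.1) (sel j b'.1 c'.1) +
    g a.2 (sel i b.2 c.2) (sel j b'.2 c'.2).
  by rewrite gromovE; case: i; case: j.
have M1 i j : sel i b.1 c.1 != sel j b'.1 c'.1 ->
    gromov a b c <= gromov a (sel i b c) (sel j b' c').
  by move=> ne; apply: M; apply: contraNneq ne; case: i; case: j => /= ->.
have M2 i j : sel i b.2 c.2 != sel j b'.2 c'.2 ->
    gromov a b c <= gromov a (sel i b c) (sel j b' c').
  by move=> ne; apply: M; apply: contraNneq ne; case: i; case: j => /= ->.
have /metric_centerE[] := metric_centerP a b c.
have /metric_centerE[] := metric_centerP a b' c'.
move: (metric_center a b c) (metric_center a b' c') => m m' x' y' x y.
rewrite !gromovE in le1 le2.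
have [xlt|xgt|xeq] := ltgtP (g a.1 b.1 c.1) (g a.1 b'.1 c'.1).
- have ylt : g a.2 b'.2 c'.2 < g a.2 b.2 c.2 by lra.
  have [i hi] := g_lt x x' xlt; have [j hj] := g_lt y' y ylt.
  have [hx nx] := hi j; have [hy _] := hj i.
  by exfalso; have := M1 i j nx; rewrite ME gromovE; rewrite gC in hy; lra.
- have ylt : g a.2 b.2 c.2 < g a.2 b'.2 c'.2 by lra.
  have [j hj] := g_lt x' x xgt; have [i hi] := g_lt y y' ylt.
  have [hy ny] := hi j; have [hx _] := hj i.
  by exfalso; have := M2 i j ny; rewrite ME gromovE; rewrite gC in hx; lra.
- have yeq : g a.2 b.2 c.2 = g a.2 b'.2 c'.2 by lra.
  have e1 : m.1 = m'.1.
    apply: contrapT => /(g_eq x x' xeq)[gx H].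
    have [i hi] := g_any b'.2 y; have [h1 n1] := H i true.
    by have := M1 i true n1; rewrite ME gromovE h1; lra.
  have e2 : m.2 = m'.2.
    apply: contrapT => /(g_eq y y' yeq)[gy H].
    have [i hi] := g_any b'.1 x; have [h1 n1] := H i true.
    by have := M2 i true n1; rewrite ME gromovE h1; lra.
  by case: m m' e1 e2 {x y x' y'} => ? ? [? ?] /= -> ->.
Qed.

Lemma center_ofE X a b c : minimizing_pair X a b c ->
  center_of X a = metric_center a b c.
Proof.
move=> abc; apply: xget_unique; first by exists b, c.
by move=> _ [b' [c' [abc' ->]]]; apply: minimizing_pair_center abc' abc.
Qed.

End WellDefined.

(* Main.v *)
Require Import Defs.
From mathcomp Require Import all_boot all_order all_algebra.
From mathcomp Require Import finmap.
From mathcomp Require Import all_classical all_reals.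
From mathcomp Require Import zify lra.

(** The key is that the point [s] of [S_X] obtained by clamping each coordinate
of [a] is a gate: every other point [p] of [X], and every point [p] of [S_X],
satisfies [d1 a p = d1 a s + d1 s p].  On one line this says that [s] lies
between [a] and [p].  It holds for the points of [X] because a coordinate of
[a] that falls outside the trimmed range [[x_2, x_{n-1}]] is the strict
extremum, so that the coordinates of all other points lie beyond the nearer
end of that range ([trimmed_range_gate]).

The gate property for the points of [S_X] makes [s] the unique nearest point,
for [d1] directly and for the Euclidean distance by squaring on each
coordinate.  The gate property for the points of [X] gives
[gromov a b c = d1 a s + gromov s b c], so minimizing the Gromov product at
[a] amounts to minimizing it at [s], where it is nonnegative by the triangle
inequality.  The value [0] is attained: each closed half-plane bounded by an
axis-parallel line through [s] contains a point of [X] other than [a], and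
then two distinct such points lie in opposite closed quadrants at [s]
([opposite_pair_exists]).  Hence every minimizing pair [(b, c)] has [s] on a
shortest path from [b] to [c], and by the gate property also on shortest paths
from [a] to [b] and to [c]: [s] is the metric center of [a, b, c]. *)

Set Implicit Arguments.
Unset Strict Implicit.
Unset Printing Implicit Defensive.

Import Order.TTheory GRing.Theory Num.Theory.

Local Open Scope fset_scope.
Local Open Scope classical_set_scope.
Local Open Scope ring_scope.

(** * One coordinate *)

Section Line.
Variable R : realType.
Implicit Types (x y z s : R) (zs : seq R).

Lemma dist_between x s y : x <= s <= y -> `|x - y| = `|x - s| + `|s - y|.
Proof.
move=> /andP[xs sy]; have xy := le_trans xs sy.
by rewrite !ler0_norm ?subr_le0 //; lra.
Qed.

Lemma dist_between_rev x s y : y <= s <= x -> `|x - y| = `|x - s| + `|s - y|.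
Proof.
by move=> /dist_between; rewrite distrC (distrC s x) (distrC y s) => ->; lra.
Qed.

(** Each claim compares the number of entries below the order statistic with
its index: two entries lie weakly below the second smallest, at most one lies
strictly below it, and dually at the other end. *)
Lemma second_order_statistics x zs
    (lo := (sort <=%R (x :: zs))`_1)
    (hi := (sort <=%R (x :: zs))`_((size zs).+1 - 2)) :
  zs != [::] ->
  [/\ has (<= lo) zs, has (>= hi) zs,
      x < lo -> all (>= lo) zs & hi < x -> all (<= hi) zs].
Proof.
rewrite -size_eq0 -lt0n => zs0; pose xs := sort <=%R (x :: zs).
have sx : sorted <=%O xs by exact: sort_le_sorted.
have cE (P : pred R) : count P xs = (P x + count P zs)%N.
  by rewrite /xs count_sort.
have szE : size xs = (size zs).+1 by rewrite size_sort.
have none (P : pred R) : ~~ has P zs -> count P zs = 0%N.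
  by rewrite has_count -eqn0Ngt => /eqP.
have full (P Q : pred R) : (forall z, P z = ~~ Q z) -> ~~ has P zs ->
    count Q zs = size zs.
  move=> PQ; rewrite -all_predC => /allP h; apply/eqP; rewrite -all_count.
  by apply/allP => z /h /=; rewrite PQ negbK.
split.
- apply/negPn/negP => h.
  suff : lo < lo by rewrite ltxx.
  apply: nth_count_gt sx _; rewrite cE none // addn0 szE.
  by rewrite leq_b1 ltnS.
- apply/negPn/negP => h.
  suff : hi < hi by rewrite ltxx.
  have below : count (< hi) zs = size zs.
    by apply: (full (>= hi)) => // z /=; rewrite leNgt.
  apply: nth_count_lt sx _; rewrite cE below.
  by rewrite subSS subn1 prednK ?leq_addl.
- move=> xlo; apply/negPn; rewrite -has_predC; apply/negP.
  rewrite has_count => h.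
  suff : lo < lo by rewrite ltxx.
  apply: nth_count_lt sx _; rewrite cE /= xlo.
  rewrite (eq_count (a2 := (< lo))) // in h => z /=.
  by rewrite ltNge.
- move=> xhi; apply/negPn; rewrite -has_predC; apply/negP => h.
  suff : hi < hi by rewrite ltxx.
  apply: nth_count_gt sx _; rewrite cE /= leNgt xhi szE add0n subSS subn1.
  rewrite -ltnS prednK // leqnSn andbT ltn_neqAle count_size andbT -all_count.
  by apply/negP => /allP all_le; case/hasP: h => z /all_le /= ->.
Qed.

(** The gate is [x] clamped to the trimmed range. *)
Lemma trimmed_range_gate x zs
    (lo := (sort <=%R (x :: zs))`_1)
    (hi := (sort <=%R (x :: zs))`_((size zs).+1 - 2)) :
  (2 <= size zs)%N ->
  exists s, [/\ lo <= s <= hi,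
    forall y, lo <= y <= hi -> `|x - y| = `|x - s| + `|s - y|,
    {in zs, forall z, `|x - z| = `|x - s| + `|s - z|},
    has (<= s) zs & has (>= s) zs].
Proof.
move=> zs2; have zs0 : zs != [::] by case: (zs) zs2.
have lohi : lo <= hi.
  apply: le_sorted_leq_nth; rewrite ?inE ?size_sort /=; try lia.
  exact: sort_le_sorted.
have [hlo hhi alo ahi] := second_order_statistics x zs0.
have weaken_lo s : lo <= s -> has (<= s) zs.
  by move=> ls; apply: sub_has hlo => z /= /le_trans; apply.
have weaken_hi s : s <= hi -> has (>= s) zs.
  by move=> sh; apply: sub_has hhi => z /=; apply: le_trans.
have [xlo|lox] := ltP x lo.
  exists lo; split; rewrite ?lexx ?lohi ?weaken_lo ?weaken_hi //.
    by move=> y /andP[loy _]; apply: dist_between; rewrite ltW.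
  by move=> z /(allP (alo xlo)) loz; apply: dist_between; rewrite ltW.
have [hix|xhi] := ltP hi x.
  exists hi; split; rewrite ?lexx ?lohi ?weaken_lo ?weaken_hi //.
    by move=> y /andP[_ yhi]; apply: dist_between_rev; rewrite yhi ltW.
  move=> z /(allP (ahi hix)) /= zhi.
  by apply: dist_between_rev; rewrite zhi ltW.
exists x; split; rewrite ?lox ?xhi ?weaken_lo ?weaken_hi //.
  by move=> y _; rewrite subrr normr0 add0r.
by move=> z _; rewrite subrr normr0 add0r.
Qed.

End Line.

(** * The plane *)

Section Plane.
Variable R : realType.
Implicit Types (a b c p q s : R * R) (X Y : {fset (R * R)}) (S : set (R * R)).

Lemma coordinate_gate (f : R * R -> R) X a
    (lo := (sort <=%R [seq f p | p <- enum_fset X])`_1)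
    (hi := (sort <=%R [seq f p | p <- enum_fset X])`_(#|` X| - 2)) :
  (3 <= #|` X|)%N -> a \in X ->
  exists s : R, [/\ lo <= s <= hi,
    forall y, lo <= y <= hi -> `|f a - y| = `|f a - s| + `|s - y|,
    {in (X `\ a)%fset, forall p, `|f a - f p| = `|f a - s| + `|s - f p|},
    exists2 p, p \in (X `\ a)%fset & f p <= s &
    exists2 p, p \in (X `\ a)%fset & s <= f p].
Proof.
move=> X3 aX; pose ps := rem a (enum_fset X); pose zs := map f ps.
have perm_ps : perm_eq (enum_fset X) (a :: ps) by exact: perm_to_rem.
have szX : #|` X| = (size zs).+1.
  by rewrite (perm_size perm_ps) /= size_map.
have mem_ps p : (p \in ps) = (p \in (X `\ a)%fset).
  by rewrite (mem_rem_uniq _ (fset_uniq X)) !inE.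
have sortE : sort <=%R [seq f p | p <- enum_fset X] = sort <=%R (f a :: zs).
  by apply/perm_sort_leP; exact: (perm_map f perm_ps).
have zs2 : (2 <= size zs)%N by rewrite -ltnS -szX.
have [s] := trimmed_range_gate (f a) zs2.
rewrite -sortE -szX -/lo -/hi => -[s_in gate_range gate_zs has_le has_ge].
exists s; split=> //.
- by move=> p; rewrite -mem_ps => pps; apply: gate_zs; exact: map_f.
- by move: has_le; rewrite has_map => /hasP[p]; rewrite mem_ps; exists p.
- by move: has_ge; rewrite has_map => /hasP[p]; rewrite mem_ps; exists p.
Qed.

Lemma d1_opposite s b c :
  (b.1 <= s.1 <= c.1) || (c.1 <= s.1 <= b.1) ->
  (b.2 <= s.2 <= c.2) || (c.2 <= s.2 <= b.2) ->
  d1 b c = d1 b s + d1 s c.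
Proof.
have line (x u y : R) : (x <= u <= y) || (y <= u <= x) ->
    `|x - y| = `|x - u| + `|u - y|.
  by case/orP; [exact: dist_between | exact: dist_between_rev].
by rewrite /d1 => /line -> /line ->; lra.
Qed.

(** A point on the left of [s] and a point on the right of [s] that are not in
opposite quadrants are both above or both below [s].  A point on the other
vertical side is then opposite to one of them.  If the two opposite points
coincide they are [s] itself, and any second point completes the pair. *)
Lemma opposite_pair_exists Y s : (2 <= #|` Y|)%N ->
  (exists2 p, p \in Y & p.1 <= s.1) -> (exists2 p, p \in Y & s.1 <= p.1) ->
  (exists2 p, p \in Y & p.2 <= s.2) -> (exists2 p, p \in Y & s.2 <= p.2) ->
  exists b c, [/\ b \in Y, c \in Y, b != c & d1 b c = d1 b s + d1 s c].
Proof.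
move=> Y2 [l lY ls] [r rY rs] [d dY ds] [u uY us].
have H p q : p \in Y -> q \in Y ->
    (p.1 <= s.1 <= q.1) || (q.1 <= s.1 <= p.1) ->
    (p.2 <= s.2 <= q.2) || (q.2 <= s.2 <= p.2) ->
    exists b c, [/\ b \in Y, c \in Y, b != c & d1 b c = d1 b s + d1 s c].
  move=> pY qY h1 h2; have [e|npq] := eqVneq p q; last first.
    by exists p, q; split=> //; exact: d1_opposite.
  have ps : p = s.
    rewrite -e !orbb in h1 h2; have := le_anti h1; have := le_anti h2.
    by case: (p) (s) => ? ? [? ?] /= -> ->.
  have /fset0Pn[t] : (Y `\ p)%fset != fset0.
    by rewrite -cardfs_gt0; move: Y2; rewrite (cardfsD1 p) pY.
  rewrite in_fsetD1 eq_sym => /andP[pt tY].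
  by exists p, t; split=> //; rewrite ps /d1 !subrr !normr0 !add0r.
have [l2|/ltW l2] := leP l.2 s.2.
- have [r2|/ltW r2] := leP s.2 r.2.
    by apply: (H l r); rewrite ?ls ?rs ?l2 ?r2.
  have [u1|/ltW u1] := leP s.1 u.1.
    by apply: (H l u); rewrite ?ls ?u1 ?l2 ?us.
  by apply: (H u r); rewrite ?u1 ?rs ?us ?r2 ?orbT.
- have [r2|/ltW r2] := leP r.2 s.2.
    by apply: (H l r); rewrite ?ls ?rs ?l2 ?r2 ?orbT.
  have [d1'|/ltW d1'] := leP s.1 d.1.
    by apply: (H l d); rewrite ?ls ?d1' ?l2 ?ds ?orbT.
  by apply: (H d r); rewrite ?d1' ?rs ?ds ?r2.
Qed.

(** Gromov products at [a] and at [s] differ by the constant [d1 a s], and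
those at [s] are nonnegative.  A pair with [s] on a geodesic has product [0] at
[s], so every minimizing pair has [s] on a geodesic too, and [s] then satisfies
the three equations of the metric center. *)
Lemma center_of_gate X a s : (3 <= #|` X|)%N -> a \in X ->
  {in (X `\ a)%fset, forall p, d1 a p = d1 a s + d1 s p} ->
  (exists b c, [/\ b \in (X `\ a)%fset, c \in (X `\ a)%fset, b != c &
    d1 b c = d1 b s + d1 s c]) ->
  center_of X a = s.
Proof.
move=> X3 aX gate [b0 [c0 [b0X c0X bc0 on0]]].
have [b [c mbc]] := minimizing_pair_exists X3 aX.
rewrite (center_ofE mbc); have [[bX cX bc] mini] := mbc.
have := mini b0 c0 (And3 b0X c0X bc0).
have d1C p q : d1 p q = d1 q p by rewrite /d1 distrC (distrC p.2).
have tri : d1 b c <= d1 b s + d1 s c.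
  rewrite /d1; have := ler_distD s.1 b.1 c.1; have := ler_distD s.2 b.2 c.2.
  lra.
rewrite /gromov (gate b) // (gate c) // (gate b0) // (gate c0) //.
rewrite on0 (d1C b0) => minE.
apply: metric_center_unique (metric_centerP a b c) _.
rewrite (d1C b s) in tri; have on : d1 b c = d1 s b + d1 s c by lra.
by split; [exact: gate | exact: gate | rewrite (d1C b s)].
Qed.

Lemma nearest_points_unique (d : R * R -> R * R -> R) S a s : S s ->
  (forall q, S q -> d a s <= d a q) ->
  (forall q, S q -> d a q <= d a s -> q = s) ->
  nearest_points d S a = [set s].
Proof.
move=> Ss min_s uniq_s; apply/seteqP; split=> q /=.
  by case=> Sq min_q; apply: uniq_s (min_q _ Ss).
by move=> ->; split.
Qed.

Lemma nearest_gate_d1 S a s : S s ->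
  (forall q, S q -> d1 a q = d1 a s + d1 s q) ->
  nearest_points (@d1 R) S a = [set s].
Proof.
move=> Ss gate; apply: nearest_points_unique => // q /gate ->.
  by rewrite lerDl /d1 addr_ge0.
rewrite gerDl /d1 => le0.
have [] : `|s.1 - q.1| = 0 /\ `|s.2 - q.2| = 0.
  by have := normr_ge0 (s.1 - q.1); have := normr_ge0 (s.2 - q.2); lra.
move=> /normr0_eq0/subr0_eq e1 /normr0_eq0/subr0_eq e2.
by case: (q) (s) e1 e2 => ? ? [? ?] /= -> ->.
Qed.

(** The angle at a gate is at least a right angle: summing the squares over the
coordinates gives [d2 a s ^+ 2 + d2 s q ^+ 2 <= d2 a q ^+ 2]. *)
Lemma nearest_gate_d2 S a s : S s ->
  (forall q, S q -> `|a.1 - q.1| = `|a.1 - s.1| + `|s.1 - q.1|) ->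
  (forall q, S q -> `|a.2 - q.2| = `|a.2 - s.2| + `|s.2 - q.2|) ->
  nearest_points (@d2 R) S a = [set s].
Proof.
move=> Ss gate1 gate2.
(* The cross term dropped from the square of a sum of distances is
   nonnegative. *)
have sq (x u y : R) : `|x - y| = `|x - u| + `|u - y| ->
    (x - u) ^+ 2 + (u - y) ^+ 2 <= (x - y) ^+ 2.
  move=> e; rewrite -(real_normK (num_real (x - y))) e [leRHS]sqrrD.
  rewrite !real_normK ?num_real //.
  by have := mulr_ge0 (normr_ge0 (x - u)) (normr_ge0 (u - y)); lra.
have bound q : S q -> (a.1 - s.1) ^+ 2 + (a.2 - s.2) ^+ 2 +
    ((s.1 - q.1) ^+ 2 + (s.2 - q.2) ^+ 2) <=
    (a.1 - q.1) ^+ 2 + (a.2 - q.2) ^+ 2.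
  move=> Sq; have := sq _ _ _ (gate1 q Sq).
  by have := sq _ _ _ (gate2 q Sq); lra.
apply: nearest_points_unique => // q /bound le_q.
  apply: ler_wsqrtr; apply: le_trans le_q.
  by rewrite lerDl addr_ge0 ?sqr_ge0.
rewrite /d2 ler_sqrt ?addr_ge0 ?sqr_ge0 // => le_s.
have [] : (s.1 - q.1) ^+ 2 = 0 /\ (s.2 - q.2) ^+ 2 = 0.
  by have := sqr_ge0 (s.1 - q.1); have := sqr_ge0 (s.2 - q.2); lra.
move=> /eqP; rewrite sqrf_eq0 => /eqP/subr0_eq e1.
move=> /eqP; rewrite sqrf_eq0 => /eqP/subr0_eq e2.
by case: (q) (s) e1 e2 => ? ? [? ?] /= -> ->.
Qed.

Lemma center_of_nearest X a : (3 <= #|` X|)%N -> a \in X ->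
  nearest_points (@d1 R) (SX X) a = [set center_of X a] /\
  nearest_points (@d2 R) (SX X) a = [set center_of X a].
Proof.
move=> X3 aX.
have [s1 [s1_in range1 gate1 left_s right_s]] := coordinate_gate fst X3 aX.
have [s2 [s2_in range2 gate2 below_s above_s]] := coordinate_gate snd X3 aX.
have XD1 : (2 <= #|` (X `\ a)%fset|)%N by move: X3; rewrite (cardfsD1 a) aX.
rewrite (center_of_gate (s := (s1, s2)) X3 aX); first last.
- exact: opposite_pair_exists.
- by move=> p pX; rewrite /d1 /= gate1 // gate2 //; lra.
have mem_S q : SX X q ->
    `|a.1 - q.1| = `|a.1 - s1| + `|s1 - q.1| /\
    `|a.2 - q.2| = `|a.2 - s2| + `|s2 - q.2|.
  by case; rewrite /= !in_itv /= => q1 q2; rewrite -range1 // -range2.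
have Ss : SX X (s1, s2) by split; rewrite /= in_itv.
split.
  by apply: nearest_gate_d1 => // q /mem_S[e1 e2]; rewrite /d1 /= e1 e2; lra.
by apply: nearest_gate_d2 => // q /mem_S[].
Qed.

Lemma center_of_in_SX X a : (3 <= #|` X|)%N -> a \in X -> SX X a ->
  center_of X a = a.
Proof.
move=> X3 aX aS; have [n1 _] := center_of_nearest X3 aX.
have : nearest_points (@d1 R) (SX X) a a.
  split=> // q _; rewrite /d1 !subrr !normr0 addr0.
  exact: addr_ge0.
by rewrite n1 /= => <-.
Qed.

Lemma projection_on_SX X a : (3 <= #|` X|)%N -> a \in X ->
  projection_on (SX X) a = center_of X a.
Proof.
move=> X3 aX; have [n1 _] := center_of_nearest X3 aX.
by apply: xget_unique; rewrite n1.
Qed.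

End Plane.

Theorem proposition2 (R : realType) (X : {fset (R * R)})
    (hX : (3 <= #|` X|)%N) :
  [/\ (forall a, a \in X ->
        nearest_points (@d1 R) (SX X) a = [set center_of X a] /\
        nearest_points (@d2 R) (SX X) a = [set center_of X a]),
      (forall a, a \in X -> SX X a -> center_of X a = a) &
      center_set X =
        ([set` X] `&` SX X) `|` [set projection_on (SX X) a | a in [set` X] `\` SX X]].
Proof.
split=> [a aX|a aX aS|]; [exact: center_of_nearest|exact: center_of_in_SX|].
apply/seteqP; split=> m.
  move=> [a aX <-]; have [aS|aS] := pselect (SX X a).
    by left; rewrite center_of_in_SX.
  by right; exists a => //; exact: projection_on_SX.
case=> [[mX mS]|[a [aX _] <-]].
  by exists m => //; exact: center_of_in_SX.
by exists a => //; rewrite projection_on_SX.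
Qed.
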